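(* Let $\mathbb{D}\in\{\mathbb{R},\mathbb{C},\mathbb{H}\}$, let $\sigma$ be a Kubo-Ando mean on $\mathscr{P}_3(\mathbb{D})$ with representing function $f$, let $A,B\in\mathscr{P}_3(\mathbb{D})$ and let $X=A^{-1/2}BA^{-1/2}$. Suppose that $|\mathrm{Spec}(X)|=2$, $\mathrm{Spec}(X)=\{\lambda_1,\lambda_2\}$, where $\lambda_1$ has geometric multiplicity $2$ and $\lambda_2$ has geometric multiplicity $1$. Then $$A\,\sigma\,B=\frac{\lambda_1f(\lambda_2)-\lambda_2f(\lambda_1)}{\lambda_1-\lambda_2}\,A+\frac{f(\lambda_1)-f(\lambda_2)}{\lambda_1-\lambda_2}\,B,$$ with $$\lambda_1=\frac{2\,\mathrm{tr}(X)+a\sqrt{6\,\mathrm{tr}(X^2)-2\,\mathrm{tr}(X)^2}}{6},\qquad \lambda_2=\frac{\mathrm{tr}(X)-a\sqrt{6\,\mathrm{tr}(X^2)-2\,\mathrm{tr}(X)^2}}{3},$$ where $a\in\{-1,1\}$ is chosen so that $\det(X)=\lambda_1^2\lambda_2$.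
   Context: $\mathscr{P}_n(\mathbb{D})$ is the set of $n\times n$ matrices $A$ over $\mathbb{D}$ that are Hermitian ($A=A^*$, with $A^*$ the conjugate transpose) and positive ($x^*Ax>0$ for all nonzero $x\in\mathbb{D}^n$). $\mathrm{Spec}(X)$ is the set of eigenvalues of $X$ (right eigenvalues $\lambda$, $Xv=v\lambda$ with $v\neq 0$, when $\mathbb{D}=\mathbb{H}$), without multiplicity. For a continuous $f:(0,\infty)\to\mathbb{R}$ and $X=U\,\mathrm{diag}(\lambda_1,\dots,\lambda_n)\,U^*\in\mathscr{P}_n(\mathbb{D})$ with $UU^*=\mathrm{Id}_n$, set $f(X)=U\,\mathrm{diag}(f(\lambda_1),\dots,f(\lambda_n))\,U^*$. For $X\in\mathscr{P}_n(\mathbb{D})$, $\mathrm{tr}(X)$ is the sum and $\det(X)$ the product of the eigenvalues of $X$ counted with multiplicity (this is the meaning of $\det$ when $\mathbb{D}=\mathbb{H}$). A Kubo-Ando mean on $\mathscr{P}_n(\mathbb{D})$ is a continuous map $\sigma:\mathscr{P}_n(\mathbb{D})\times\mathscr{P}_n(\mathbb{D})\to\mathscr{P}_n(\mathbb{D})$ that is monotone in both arguments for the Loewner order, satisfies $g(A\,\sigma\,B)g^*=(gAg^* )\,\sigma\,(gBg^* )$ for all $g\in\mathrm{GL}_n(\mathbb{D})$, and satisfies $\mathrm{Id}_n\,\sigma\,\mathrm{Id}_n=\mathrm{Id}_n$. By the Kubo-Ando correspondence, used throughout, it is given by $A\,\sigma\,B=A^{1/2}f(A^{-1/2}BA^{-1/2})A^{1/2}$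 for a unique operator monotone function $f:(0,\infty)\to(0,\infty)$ with $f(1)=1$, called its representing function. *)

(* Defs.v *)
From HB Require Import structures.
From mathcomp Require Import all_boot all_order all_algebra.
From mathcomp Require Import complex ring.
From mathcomp Require Import boolp classical_sets reals topology normedtype.
Set Implicit Arguments.
Unset Strict Implicit.
Unset Printing Implicit Defensive.
Import Order.TTheory GRing.Theory Num.Theory.
Import numFieldNormedType.Exports.
Local Open Scope ring_scope.
Local Open Scope classical_set_scope.

(* Quat a b c d is the quaternion a + b i + c j + d k. *)
Record quat (R : Type) := Quat { qre : R; qi : R; qj : R; qk : R }.

Section QuatRing.
Variable R : realType.

Definition quat_to_prod (x : quat R) : R * R * R * R :=
  (qre x, qi x, qj x, qk x).
Definition quat_of_prod (p : R * R * R * R) : quat R :=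
  let: (a, b, c, d) := p in Quat a b c d.
Lemma quat_to_prodK : cancel quat_to_prod quat_of_prod.
Proof. by case. Qed.

HB.instance Definition _ := Choice.copy (quat R) (can_type quat_to_prodK).

Definition qadd (x y : quat R) : quat R :=
  Quat (qre x + qre y) (qi x + qi y) (qj x + qj y) (qk x + qk y).
Definition qopp (x : quat R) : quat R :=
  Quat (- qre x) (- qi x) (- qj x) (- qk x).
Definition qmul (x y : quat R) : quat R :=
  Quat (qre x * qre y - qi x * qi y - qj x * qj y - qk x * qk y)
       (qre x * qi y + qi x * qre y + qj x * qk y - qk x * qj y)
       (qre x * qj y - qi x * qk y + qj x * qre y + qk x * qi y)
       (qre x * qk y + qi x * qj y - qj x * qi y + qk x * qre y).
Definition qreal (r : R) : quat R := Quat r 0 0 0.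

Lemma qaddA : associative qadd.
Proof. by move=> [????] [????] [????]; congr Quat => /=; ring. Qed.
Lemma qaddC : commutative qadd.
Proof. by move=> [????] [????]; congr Quat => /=; ring. Qed.
Lemma qadd0 : left_id (qreal 0) qadd.
Proof. by move=> [????]; congr Quat => /=; ring. Qed.
Lemma qaddN : left_inverse (qreal 0) qopp qadd.
Proof. by move=> [????]; congr Quat => /=; ring. Qed.

HB.instance Definition _ := GRing.isZmodule.Build (quat R)
  qaddA qaddC qadd0 qaddN.

Lemma qmulA : associative qmul.
Proof. by move=> [????] [????] [????]; congr Quat => /=; ring. Qed.
Lemma qmul1 : left_id (qreal 1) qmul.
Proof. by move=> [????]; congr Quat => /=; ring. Qed.
Lemma qmulr1 : right_id (qreal 1) qmul.
Proof. by move=> [????]; congr Quat => /=; ring. Qed.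
Lemma qmulDl : left_distributive qmul qadd.
Proof. by move=> [????] [????] [????]; congr Quat => /=; ring. Qed.
Lemma qmulDr : right_distributive qmul qadd.
Proof. by move=> [????] [????] [????]; congr Quat => /=; ring. Qed.
Lemma qoner_neq0 : qreal 1 != 0.
Proof. by apply/eqP => -[] /eqP; rewrite oner_eq0. Qed.

HB.instance Definition _ := GRing.Zmodule_isNzRing.Build (quat R)
  qmulA qmul1 qmulr1 qmulDl qmulDr qoner_neq0.

Definition qconj (x : quat R) : quat R :=
  Quat (qre x) (- qi x) (- qj x) (- qk x).
Definition qnorm (x : quat R) : R :=
  Num.sqrt (qre x ^+ 2 + qi x ^+ 2 + qj x ^+ 2 + qk x ^+ 2).

End QuatRing.

(* The data common to the three scalar rings. The record carries no axioms: it
   is only used at realA, complexA and quatA. *)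
Record scalars (R : realType) := Scalars {
  scal :> nzRingType;
  sconj : scal -> scal;
  sreal : R -> scal;
  snorm : scal -> R }.

Definition realA (R : realType) : scalars R :=
  @Scalars R R (fun x => x) (fun x => x) (fun x => `|x|).
Definition complexA (R : realType) : scalars R :=
  @Scalars R R[i] (fun z => conjc z) (fun x => real_complex R x)
    (fun z => Normc.normc z).
Definition quatA (R : realType) : scalars R :=
  @Scalars R (quat R) (@qconj R) (@qreal R) (@qnorm R).

Section Matrices.
Variables (R : realType) (D : scalars R).

Definition adjmx m n (A : 'M[D]_(m, n)) : 'M[D]_(n, m) :=
  map_mx (@sconj R D) A^T.

Definition hermitian n (A : 'M[D]_n) : Prop := A = adjmx A.

Definition posdef n (A : 'M[D]_n) : Prop :=
  hermitian A /\
  forall x : 'cV[D]_n, x != 0 ->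
    exists2 r : R, 0 < r & adjmx x *m A *m x = (sreal D r)%:M.

Definition possemidef n (A : 'M[D]_n) : Prop :=
  hermitian A /\
  forall x : 'cV[D]_n,
    exists2 r : R, 0 <= r & adjmx x *m A *m x = (sreal D r)%:M.

Definition loewner_le n (A B : 'M[D]_n) : Prop := possemidef (B - A).

(* As D need not be commutative, v *m l%:M is v l, the column v multiplied by
   the scalar l on the right. *)
Definition spec n (X : 'M[D]_n) : set D :=
  [set l | exists2 v : 'cV[D]_n, v != 0 & X *m v = v *m l%:M].

(* The columns of V form a basis of the right D-vector space of the v such that
   X v = v l. The eigenvalue l is real, hence central in D, which makes this set
   a right subspace. *)
Definition geom_mult n (X : 'M[D]_n) (l : R) (k : nat) : Prop :=
  exists V : 'M[D]_(n, k),
    (forall c : 'cV[D]_k, V *m c = 0 -> c = 0) /\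
    (forall v : 'cV[D]_n,
       X *m v = v *m (sreal D l)%:M <-> exists c : 'cV[D]_k, v = V *m c).

Definition rdiag n (d : 'rV[R]_n) : 'M[D]_n := diag_mx (map_mx (@sreal R D) d).

Definition unitarily_diagonalizes n (X : 'M[D]_n) (Ud : 'M[D]_n * 'rV[R]_n) :
    Prop :=
  Ud.1 *m adjmx Ud.1 = 1%:M /\ X = Ud.1 *m rdiag Ud.2 *m adjmx Ud.1.

(* A chosen pair (U, d) with U U^* = 1 and X = U diag(d) U^*; it has this
   property whenever X is Hermitian, and none of the notions below depends on
   the choice. On other X it is a default value. *)
Definition eigdec n (X : 'M[D]_n) : 'M[D]_n * 'rV[R]_n :=
  xget (1%:M, 0) [set Ud | unitarily_diagonalizes X Ud].

Definition mxfun n (f : R -> R) (X : 'M[D]_n) : 'M[D]_n :=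
  (eigdec X).1 *m rdiag (map_mx f (eigdec X).2) *m adjmx (eigdec X).1.

Definition eigtr n (X : 'M[D]_n) : R := \sum_(i < n) (eigdec X).2 0 i.
Definition eigdet n (X : 'M[D]_n) : R := \prod_(i < n) (eigdec X).2 0 i.

Definition mxsqrt n (A : 'M[D]_n) : 'M[D]_n := mxfun (fun x => Num.sqrt x) A.
Definition mxisqrt n (A : 'M[D]_n) : 'M[D]_n :=
  mxfun (fun x => (Num.sqrt x)^-1) A.

Definition mx_near n (e : R) (A B : 'M[D]_n) : Prop :=
  forall i j, snorm (A i j - B i j) < e.

(* Only the values of s at pairs of positive matrices matter. *)
Definition posdef_continuous n (s : 'M[D]_n -> 'M[D]_n -> 'M[D]_n) : Prop :=
  forall A B, posdef A -> posdef B ->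
  forall e : R, 0 < e -> exists2 d : R, 0 < d &
  forall A' B', posdef A' -> posdef B' -> mx_near d A' A -> mx_near d B' B ->
    mx_near e (s A' B') (s A B).

Definition GL n (g : 'M[D]_n) : Prop :=
  exists2 h : 'M[D]_n, g *m h = 1%:M & h *m g = 1%:M.

Definition kubo_ando_mean n (s : 'M[D]_n -> 'M[D]_n -> 'M[D]_n) : Prop :=
  [/\ forall A B, posdef A -> posdef B -> posdef (s A B),
      posdef_continuous s,
      forall A A' B B', posdef A -> posdef A' -> posdef B -> posdef B' ->
        loewner_le A A' -> loewner_le B B' -> loewner_le (s A B) (s A' B'),
      forall g A B, GL g -> posdef A -> posdef B ->
        g *m s A B *m adjmx g = s (g *m A *m adjmx g) (g *m B *m adjmx g) &
      s 1%:M 1%:M = 1%:M].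

(* Functions on (0, oo) are functions on R whose values outside (0, oo) are
   ignored. *)
Definition operator_monotone (f : R -> R) : Prop :=
  (forall x : R, 0 < x -> {for x, continuous f}) /\
  (forall n (A B : 'M[D]_n), posdef A -> posdef B ->
     loewner_le A B -> loewner_le (mxfun f A) (mxfun f B)).

Definition representing_function n (s : 'M[D]_n -> 'M[D]_n -> 'M[D]_n)
    (f : R -> R) : Prop :=
  [/\ forall x, 0 < x -> 0 < f x, operator_monotone f, f 1 = 1 &
      forall A B, posdef A -> posdef B ->
        s A B =
        mxsqrt A *m mxfun f (mxisqrt A *m B *m mxisqrt A) *m mxsqrt A].

End Matrices.

(* Main.v *)
(* Gram-Schmidt in the two eigenspaces of X, which are orthogonal because X is
   Hermitian, diagonalizes X with eigenvalues l1, l1, l2. As f agrees on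
   {l1, l2} with an affine function p, f(X) = p(X), and conjugating by A^(1/2)
   sends X to B and the identity to A. The formulas for l1 and l2 solve
   tr X = 2 l1 + l2, tr X^2 = 2 l1^2 + l2^2; the real part of the trace is
   invariant under conjugation because re (x y) = re (y x), also for
   quaternions, so these traces do not depend on the chosen diagonalization.
   No spectral theorem for A is needed: if A had no diagonalization, mxisqrt A
   would be 0, hence X = 0, which has only one eigenvalue. *)
Require Import Defs.
From mathcomp Require Import all_boot all_order all_algebra complex ring lra.
From mathcomp Require Import boolp classical_sets reals.
Set Implicit Arguments.
Unset Strict Implicit.
Unset Printing Implicit Defensive.
Import Order.TTheory GRing.Theory Num.Theory.
Local Open Scope ring_scope.
Local Open Scope classical_set_scope.

(** * The three scalar rings treated uniformly *)

(** These are the common properties of the reals, complex numbers and quaternions on which the proof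
    rests. Real scalars are central, [reMC] stands in for commutativity under traces, and the last
    two fields provide inverses and positive lengths. *)
Record star_division (R : realType) (D : scalars R) (re : D -> R) : Prop :=
  StarDivision {
    sconjD : {morph @sconj R D : x y / x + y};
    sconjM : forall x y : D, sconj (x * y) = sconj y * sconj x;
    sconjK : involutive (@sconj R D);
    sconj_sreal : forall r, sconj (sreal D r) = sreal D r;
    srealD : {morph sreal D : r t / r + t};
    srealM : {morph sreal D : r t / r * t};
    sreal1 : sreal D 1 = 1;
    sreal_comm : forall r (x : D), sreal D r * x = x * sreal D r;
    reD : {morph re : x y / x + y};
    re_sreal : forall r, re (sreal D r) = r;
    reMC : forall x y, re (x * y) = re (y * x);
    sconj_mul : forall x : D, sconj x * x = sreal D (re (sconj x * x));
    sconj_mul_gt0 : forall x : D, x != 0 -> 0 < re (sconj x * x) }.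

Lemma realA_star_division (R : realType) :
  @star_division R (realA R) (fun x : R => x).
Proof.
split=> //= [x y|r x|x y|x x0]; try exact: mulrC.
by rewrite -expr2 lt_neqAle eq_sym sqrf_eq0 x0 sqr_ge0.
Qed.

Lemma complexA_star_division (R : realType) :
  @star_division R (complexA R) (@complex.Re R).
Proof.
split=> //=.
- by move=> [a b] [c d]; congr Complex => /=; ring.
- by move=> [a b] [c d]; congr Complex => /=; ring.
- by move=> [a b]; congr Complex; rewrite opprK.
- by move=> r; congr Complex; rewrite oppr0.
- by move=> r t; congr Complex; rewrite /= ?addr0.
- by move=> r t; congr Complex => /=; ring.
- by move=> r x; exact: mulrC.
- by move=> [a b] [c d].
- by move=> x y; rewrite mulrC.
- by move=> [a b]; congr Complex => /=; ring.
- move=> [a b] ab0 /=.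
  have -> : a * a - - b * b = a ^+ 2 + b ^+ 2 by ring.
  rewrite lt_neqAle eq_sym paddr_eq0 ?sqr_ge0 // !sqrf_eq0 addr_ge0 ?sqr_ge0 //.
  by rewrite andbT; apply: contra ab0 => /andP[/eqP -> /eqP ->].
Qed.

Lemma quatA_star_division (R : realType) :
  @star_division R (quatA R) (@qre R).
Proof.
split=> //=.
- by move=> [????] [????]; congr Quat => /=; ring.
- by move=> [????] [????]; congr Quat => /=; ring.
- by move=> [????]; congr Quat; rewrite /= opprK.
- by move=> r; congr Quat; rewrite /= oppr0.
- by move=> r t; congr Quat; rewrite /= ?addr0.
- by move=> r t; congr Quat => /=; ring.
- by move=> r [????]; congr Quat => /=; ring.
- by move=> [a b c d] [a' b' c' d'] /=; ring.
- by move=> [????]; congr Quat => /=; ring.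
- move=> [a b c d] x0 /=.
  have -> : a * a - - b * b - - c * c - - d * d
    = a ^+ 2 + b ^+ 2 + c ^+ 2 + d ^+ 2 by ring.
  rewrite lt_neqAle eq_sym !paddr_eq0 ?addr_ge0 ?sqr_ge0 // !sqrf_eq0.
  rewrite andbT; apply: contra x0.
  by move=> /andP[/andP[/andP[/eqP -> /eqP ->] /eqP ->] /eqP ->].
Qed.

Lemma star_division_ex (R : realType) (D : scalars R) :
  [\/ D = realA R, D = complexA R | D = quatA R] ->
  exists re : D -> R, star_division re.
Proof.
by case=> ->; [exists (fun x : R => x); exact: realA_star_division
  | exists (@complex.Re R); exact: complexA_star_division
  | exists (@qre R); exact: quatA_star_division].
Qed.

Section StarDivision.
Variables (R : realType) (D : scalars R) (re : D -> R).
Hypothesis hD : star_division re.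

Local Notation srl := (sreal D).

Lemma sreal0 : srl 0 = 0.
Proof. by apply: (@addrI _ (srl 0)); rewrite -(srealD hD) !addr0. Qed.

Lemma sreal_sum I (r : seq I) (P : pred I) (F : I -> R) :
  srl (\sum_(i <- r | P i) F i) = \sum_(i <- r | P i) srl (F i).
Proof. exact: (big_morph _ (srealD hD) sreal0). Qed.

Lemma sreal_inj : injective srl.
Proof. by move=> r t E; rewrite -(re_sreal hD r) E (re_sreal hD). Qed.

Lemma sconj0 : sconj (0 : D) = 0.
Proof. by rewrite -sreal0 (sconj_sreal hD). Qed.

Lemma sconj_sum I (r : seq I) (P : pred I) (F : I -> D) :
  sconj (\sum_(i <- r | P i) F i) = \sum_(i <- r | P i) sconj (F i).
Proof. exact: (big_morph _ (sconjD hD) sconj0). Qed.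

Lemma re0 : re 0 = 0.
Proof. by rewrite -sreal0 (re_sreal hD). Qed.

Lemma re_sum I (r : seq I) (P : pred I) (F : I -> D) :
  re (\sum_(i <- r | P i) F i) = \sum_(i <- r | P i) re (F i).
Proof. exact: (big_morph _ (reD hD) re0). Qed.

(** * One-sided inverses without commutativity *)

Lemma left_inverse_ex (x : D) : x != 0 -> exists y : D, y * x = 1.
Proof.
move=> x0; exists (srl (re (sconj x * x))^-1 * sconj x).
rewrite -mulrA (sconj_mul hD) (re_sreal hD) -(srealM hD) mulVf ?(sreal1 hD) //.
by rewrite gt_eqF // (sconj_mul_gt0 hD).
Qed.

(** Gaussian elimination: a pivot row clears column 0, and induction applies to the remaining rows
    and columns. The kernel vector is a row because the rows are combined with coefficients on the
    left. *)
Lemma left_kernel_ex n (A : 'M[D]_(n.+1, n)) :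
  exists2 x : 'rV[D]_n.+1, x != 0 & x *m A = 0.
Proof.
elim: n A => [|n IHn] A.
  exists (const_mx 1); last by apply/matrixP => ? [].
  by apply/eqP => /matrixP /(_ 0 0) /eqP; rewrite !mxE oner_eq0.
(* [q] inverts a nonzero pivot [A i 0]; if column 0 vanishes, [q = 0] satisfies the same identity,
   so both cases continue together. *)
have [i [q hq]] : exists i, exists q, forall k, A k 0 * q * A i 0 = A k 0.
  have [[i Ai]|A0] := pselect (exists i, A i 0 != 0).
    have [q hq] := left_inverse_ex Ai.
    by exists i, q => k; rewrite -mulrA hq mulr1.
  exists 0, 0 => k; rewrite mulr0 mul0r; apply/esym/eqP.
  by apply: contra_notT A0 => ?; exists k.
pose M := \matrix_(k < n.+1, j < n)
  (A (lift i k) (lift 0 j) - A (lift i k) 0 * q * A i (lift 0 j)).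
have [x' x0 xM] := IHn M.
(* The coefficient of the pivot row collects the multiples subtracted in [M], so [x *m A] is the
   combination of the cleared rows with coefficients [x']. *)
pose x := \row_j if unlift i j is Some k then x' 0 k
                 else - \sum_k x' 0 k * A (lift i k) 0 * q.
exists x.
  apply: contra x0 => /eqP x0; apply/eqP/rowP => k.
  by move/rowP: x0 => /(_ (lift i k)); rewrite !mxE liftK.
have xA c : (x *m A) 0 c
    = \sum_k (x' 0 k * (A (lift i k) c - A (lift i k) 0 * q * A i c)).
  rewrite mxE (bigD1_ord i) //= !mxE unlift_none mulNr mulr_suml addrC -sumrB.
  by apply: eq_bigr => k _; rewrite !mxE liftK mulrBr !mulrA.
apply/rowP => c; rewrite xA mxE; have [j ->|->] := unliftP 0 c.
  have := congr1 (fun B : 'rV[D]_n => B 0 j) xM; rewrite !mxE; apply: etrans.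
  by apply: eq_bigr => k _; rewrite mxE.
by rewrite big1 // => k _; rewrite hq subrr mulr0.
Qed.

(** A unit row [e] and the rows of [U] are n+1 rows of length n, hence dependent. The rows of [U]
    alone are independent since [U V = 1], so [e = y U] for some [y], and
    [e V U = y U V U = y U = e]. *)
Lemma star_mulmx1C n (U V : 'M[D]_n) : U *m V = 1%:M -> V *m U = 1%:M.
Proof.
move=> UV; apply/row_matrixP => i; rewrite row_mul.
have [x x0 xA] := @left_kernel_ex n (col_mx (row i 1%:M) U).
have [t [y xE]] : exists t : 'M[D]_1, exists y, x = row_mx t y.
  by exists (@lsubmx _ 1 1 n x), (@rsubmx _ 1 1 n x); rewrite hsubmxK.
have /eqP : t *m row i 1%:M + y *m U = 0 by rewrite xE in xA; rewrite -mul_row_col.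
rewrite addr_eq0 => /eqP E.
have t0 : t 0 0 != 0.
  apply: contra x0 => /eqP t0; rewrite xE.
  have tE : t = 0 by apply/matrixP => a b; rewrite !ord1 t0 mxE.
  move: E; rewrite tE mul0mx => /esym/eqP; rewrite oppr_eq0 => /eqP yU.
  by rewrite -[y]mulmx1 -UV mulmxA yU mul0mx row_mx0.
have [t' t't] := left_inverse_ex t0.
have tE : t'%:M *m t = 1%:M.
  by apply/matrixP => a b; rewrite !ord1 mul_scalar_mx !mxE eqxx t't.
have eE : row i 1%:M = - (t'%:M *m y) *m U.
  by rewrite -[LHS]mul1mx -tE -mulmxA E mulmxN mulmxA mulNmx.
rewrite rowE -(mulmxA (delta_mx _ _)) -rowE.
rewrite rowE mulmxA -rowE; move: eE; rewrite !rowE mulmx1 => ->.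
by rewrite -!mulmxA (mulmxA U) UV mul1mx.
Qed.

(** * Adjoints, real diagonal matrices and traces *)

Local Notation "A ^H" := (adjmx A) (at level 1, format "A ^H") : ring_scope.

Lemma adjmxM m n p (A : 'M[D]_(m, n)) (B : 'M[D]_(n, p)) :
  (A *m B)^H = B^H *m A^H.
Proof.
apply/matrixP => i j; rewrite !mxE sconj_sum.
by apply: eq_bigr => k _; rewrite !mxE (sconjM hD).
Qed.

Lemma adjmxK m n (A : 'M[D]_(m, n)) : A^H^H = A.
Proof. by apply/matrixP => i j; rewrite !mxE (sconjK hD). Qed.

Lemma adj_rdiag n (d : 'rV[R]_n) : (rdiag D d)^H = rdiag D d.
Proof.
apply/matrixP => i j; rewrite !mxE eq_sym.
by case: eqP => [->|_]; rewrite ?mulr1n ?mulr0n ?(sconj_sreal hD) ?sconj0.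
Qed.

Lemma rdiagM n (d e : 'rV[R]_n) :
  rdiag D d *m rdiag D e = rdiag D (\row_i (d 0 i * e 0 i)).
Proof.
rewrite mul_diag_mx; apply/matrixP => i j; rewrite !mxE.
by case: eqP => [->|_]; rewrite ?mulr1n ?mulr0n ?(srealM hD) ?mulr0.
Qed.

Lemma rdiag_const n (r : R) : rdiag D (const_mx r : 'rV_n) = (srl r)%:M.
Proof. by apply/matrixP => i j; rewrite !mxE. Qed.

Lemma sreal_scalemx_commr m n p r (A : 'M[D]_(m, n)) (B : 'M[D]_(n, p)) :
  A *m (srl r *: B) = srl r *: (A *m B).
Proof.
apply/matrixP => i j; rewrite !mxE mulr_sumr.
by apply: eq_bigr => k _; rewrite mxE !mulrA (sreal_comm hD).
Qed.

Lemma mulmx_sreal m n r (A : 'M[D]_(m, n)) : A *m (srl r)%:M = srl r *: A.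
Proof. by rewrite -[_%:M]scalemx1 sreal_scalemx_commr mulmx1. Qed.

Lemma re_trMC n (A B : 'M[D]_n) : re (\tr (A *m B)) = re (\tr (B *m A)).
Proof.
rewrite /mxtrace !re_sum.
under eq_bigr do rewrite mxE re_sum.
rewrite exchange_big /=; apply: eq_bigr => i _; rewrite mxE re_sum.
by apply: eq_bigr => j _; rewrite (reMC hD).
Qed.

(** * From orthogonal eigenvectors to a unitary diagonalization *)

Lemma mul_adj_col n (x : 'cV[D]_n) :
  x != 0 -> exists2 r, 0 < r & x^H *m x = (srl r)%:M.
Proof.
move=> x0; exists (\sum_i re (sconj (x i 0) * x i 0)).
  have [i xi] : exists i, x i 0 != 0.
    apply: contra_notP (negP x0) => h; apply/eqP/colP => i; rewrite mxE.
    by apply/eqP; apply: contra_notT h => ?; exists i.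
  rewrite (bigD1 i) //= ltr_wpDr ?(sconj_mul_gt0 hD) // sumr_ge0 // => j _.
  have [->|xj] := eqVneq (x j 0) 0; first by rewrite mulr0 re0.
  exact/ltW/(sconj_mul_gt0 hD).
apply/matrixP => a b; rewrite !ord1 !mxE mulr1n sreal_sum.
by apply: eq_bigr => i _; rewrite !mxE -(sconj_mul hD).
Qed.

(** The eigenvectors, divided by their lengths, are the columns of [U]. Orthonormality gives
    [U^H U = 1]; the required [U U^H = 1] follows from [star_mulmx1C]. *)
Lemma unitarily_diagonalizes_orthogonal n (X : 'M[D]_n) (c : 'I_n -> 'cV[D]_n)
    (d : 'rV[R]_n) :
  (forall i, c i != 0) -> (forall i j, i != j -> (c i)^H *m c j = 0) ->
  (forall i, X *m c i = c i *m (srl (d 0 i))%:M) ->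
  exists U, unitarily_diagonalizes X (U, d).
Proof.
move=> c0 cc Xc.
have /choice[r hr] : forall i, exists r, 0 < r /\ (c i)^H *m c i = (srl r)%:M.
  by move=> i; have [r ? ?] := mul_adj_col (c0 i); exists r.
pose q i := (Num.sqrt (r i))^-1.
pose U := \matrix_(i, j) (srl (q j) *: c j) i 0.
have UU : U^H *m U = 1%:M.
  apply/matrixP => i j.
  have -> : (U^H *m U) i j = srl (q i * q j) * ((c i)^H *m c j) 0 0.
    rewrite !mxE mulr_sumr; apply: eq_bigr => k _.
    rewrite !mxE (sconjM hD) (sconj_sreal hD) (srealM hD) -(sreal_comm hD (q i)).
    by rewrite -!mulrA; congr (_ * _); rewrite !mulrA (sreal_comm hD).
  have [<-|ij] := eqVneq i j; last by rewrite cc // !mxE mulr0 (negPf ij).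
  have [r0 ->] := hr i; rewrite !mxE !eqxx mulr1n -(srealM hD) /q -invfM -expr2.
  by rewrite sqr_sqrtr ?ltW // mulVf ?gt_eqF // (sreal1 hD).
exists U; split=> /=; first exact: star_mulmx1C UU.
have XU : X *m U = U *m rdiag D d.
  apply/matrixP => i j; rewrite mul_mx_diag !mxE.
  move/matrixP: (Xc j) => /(_ i 0); rewrite mulmx_sreal !mxE => E.
  rewrite -!mulrA -(sreal_comm hD (d 0 j)) -E mulr_sumr.
  by apply: eq_bigr => k _; rewrite !mxE !mulrA (sreal_comm hD).
by rewrite -XU -mulmxA (star_mulmx1C UU) mulmx1.
Qed.

(** * Spectrum, trace and affine functions of a diagonalized matrix *)

Section Diagonalized.
Variables (n : nat) (X U : 'M[D]_n) (d : 'rV[R]_n).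
Hypothesis XUd : unitarily_diagonalizes X (U, d).

Lemma diag_eigvec i : col i U != 0 /\ X *m col i U = col i U *m (srl (d 0 i))%:M.
Proof.
have [/= UU' XE] := XUd; have UU := star_mulmx1C UU'.
split.
  apply/eqP => U0; have /matrixP/(_ i i) := UU; rewrite !mxE eqxx big1.
    by move=> /esym/eqP; rewrite oner_eq0.
  by move=> k _; move/colP: U0 => /(_ k); rewrite !mxE => ->; rewrite mulr0.
have dE : rdiag D d *m delta_mx i 0 = delta_mx i 0 *m (srl (d 0 i))%:M :> 'cV_n.
  rewrite mulmx_sreal mul_diag_mx; apply/colP => k; rewrite !mxE.
  by case: eqP => [->|_] //; rewrite !mulr0.
by rewrite !colE XE -!mulmxA (mulmxA U^H) UU mul1mx dE.
Qed.

Lemma diag_spec i : spec X (srl (d 0 i)).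
Proof. by have [] := diag_eigvec i; exists (col i U). Qed.

Lemma diag_re_tr : re (\tr X) = \sum_i d 0 i.
Proof.
have [/= UU' ->] := XUd; rewrite re_trMC mulmxA (star_mulmx1C UU') mul1mx.
rewrite /mxtrace re_sum; apply: eq_bigr => i _.
by rewrite !mxE eqxx mulr1n (re_sreal hD).
Qed.

Lemma diag_sqr :
  unitarily_diagonalizes (X *m X) (U, \row_i (d 0 i * d 0 i)).
Proof.
have [/= UU' XE] := XUd; split=> //=; rewrite XE -!mulmxA (mulmxA U^H).
by rewrite (star_mulmx1C UU') mul1mx (mulmxA (rdiag _ _)) rdiagM.
Qed.

Lemma diag_affine (a b : R) :
  U *m rdiag D (\row_i (a * d 0 i + b)) *m U^H = srl a *: X + (srl b)%:M.
Proof.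
have [/= UU' ->] := XUd.
have -> : rdiag D (\row_i (a * d 0 i + b)) = srl a *: rdiag D d + (srl b)%:M.
  apply/matrixP => i j; rewrite !mxE (srealD hD) (srealM hD).
  by case: eqP => [->|_]; rewrite ?mulr1n ?mulr0n ?mulr0 ?addr0.
rewrite mulmxDr mulmxDl sreal_scalemx_commr mulmx_sreal -!scalemxAl UU'.
by rewrite scalemx1.
Qed.

End Diagonalized.

(** * Functional calculus through the chosen diagonalization *)

(** The pair [(U, d)] serves only to show that the choice in [eigdec] does not fall back on its
    default value. *)
Lemma eigdecP n (X : 'M[D]_n) U d :
  unitarily_diagonalizes X (U, d) -> unitarily_diagonalizes X (eigdec X).
Proof. by move=> h; exact: (@xgetI _ _ _ (U, d)). Qed.

Lemma eigtrE n (X : 'M[D]_n) U d :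
  unitarily_diagonalizes X (U, d) -> eigtr X = re (\tr X).
Proof.
by move=> /eigdecP; rewrite /eigtr; case: (eigdec X) => V e /diag_re_tr.
Qed.

(** All chosen eigenvalues lie in the spectrum, where [f] is affine, and affine functions with real
    coefficients commute with conjugation by a unitary matrix. *)
Lemma mxfun_affine n (X : 'M[D]_n) U d f a b :
  unitarily_diagonalizes X (U, d) ->
  (forall l, spec X (srl l) -> f l = a * l + b) ->
  mxfun f X = srl a *: X + (srl b)%:M.
Proof.
move=> /eigdecP; rewrite /mxfun; case: (eigdec X) => V e /= h fE.
rewrite -(diag_affine h); congr (_ *m rdiag D _ *m _); apply/rowP => i.
by rewrite !mxE fE //; exact: diag_spec h i.
Qed.

Lemma mxfun_adj n f (A : 'M[D]_n) : (mxfun f A)^H = mxfun f A.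
Proof. by rewrite /mxfun !adjmxM adjmxK adj_rdiag mulmxA. Qed.

(* The default value of [eigdec] has zero eigenvalues, and [0^-1 = 0]. *)
Lemma mxisqrt_default n (A : 'M[D]_n) :
  ~ unitarily_diagonalizes A (eigdec A) -> mxisqrt A = 0.
Proof.
move=> nA; rewrite /mxisqrt /mxfun /eigdec; case: xgetP => /= [Ud _ h|_].
  by case: nA; apply: (@eigdecP _ _ Ud.1 Ud.2); case: Ud h.
rewrite mul1mx [rdiag _ _](_ : _ = 0) ?mul0mx //; apply/matrixP => i j.
by rewrite !mxE sqrtr0 invr0 sreal0 mul0rn.
Qed.

(** For [u = col i U], the positive number [u^H A u] equals [d 0 i] times the positive number
    [u^H u]. *)
Lemma posdef_eigval_gt0 n (A U : 'M[D]_n) d :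
  posdef A -> unitarily_diagonalizes A (U, d) -> forall i, 0 < d 0 i.
Proof.
move=> [_ Ap] h i; have [u0 Au] := diag_eigvec h i.
have [r r0 rE] := Ap _ u0; have [t t0 tE] := mul_adj_col u0.
move: rE; rewrite -mulmxA Au mulmxA tE mulmx_sreal => /matrixP/(_ 0 0).
rewrite !mxE !eqxx !mulr1n -(srealM hD) => /sreal_inj E.
by move: r0; rewrite -E pmulr_lgt0.
Qed.

(** Both roots are diagonal in the same [U], so each product reduces to an identity for the square
    root of a positive eigenvalue. *)
Lemma posdef_sqrt n (A : 'M[D]_n) :
  posdef A -> unitarily_diagonalizes A (eigdec A) ->
  [/\ mxsqrt A *m mxsqrt A = A, mxsqrt A *m mxisqrt A = 1%:M &
      mxisqrt A *m mxsqrt A = 1%:M].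
Proof.
move=> Ap h; rewrite /mxsqrt /mxisqrt /mxfun; move: h.
case: (eigdec A) => U d /= h; have d0 := posdef_eigval_gt0 Ap h.
have [/= UU' AE] := h; have UU := star_mulmx1C UU'.
have mulS e e' : U *m rdiag D e *m U^H *m (U *m rdiag D e' *m U^H) =
    U *m rdiag D (\row_i (e 0 i * e' 0 i)) *m U^H.
  by rewrite -!mulmxA (mulmxA U^H) UU mul1mx (mulmxA (rdiag _ _)) rdiagM.
have s0 i : Num.sqrt (d 0 i) != 0 by rewrite sqrtr_eq0 -ltNge.
have one (e : 'rV_n) : (forall i, e 0 i = 1) -> U *m rdiag D e *m U^H = 1%:M.
  move=> e1; have -> : e = const_mx 1 by apply/rowP => i; rewrite e1 mxE.
  by rewrite rdiag_const (sreal1 hD) mulmx1.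
split; rewrite mulS.
- rewrite [RHS]AE; congr (_ *m rdiag D _ *m _); apply/rowP => i.
  by rewrite !mxE -expr2 sqr_sqrtr // ltW.
- by apply: one => i; rewrite !mxE divff.
- by apply: one => i; rewrite !mxE mulVf.
Qed.

(** * Diagonalization from the two eigenspaces *)

(** Evaluating [v^H X w] on either side gives [l v^H w = m v^H w], and the real scalar [l - m] is
    invertible. *)
Lemma hermitian_eigvec_orthogonal n (X : 'M[D]_n) (l m : R) (v w : 'cV[D]_n) :
  Defs.hermitian X -> l != m ->
  X *m v = v *m (srl l)%:M -> X *m w = w *m (srl m)%:M -> v^H *m w = 0.
Proof.
move=> XH lm Xv Xw.
have E : (X *m v)^H *m w = v^H *m (X *m w) by rewrite adjmxM -XH mulmxA.
move: E; rewrite Xv Xw adjmxM mulmxA -(rdiag_const 1 l) adj_rdiag rdiag_const.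
rewrite mulmx_sreal mul_scalar_mx -scalemxAl => /eqP.
rewrite -subr_eq0 -scalerBl => /eqP E.
have lm0 : l - m != 0 by rewrite subr_eq0.
rewrite -[LHS]scale1r -(sreal1 hD) -(mulVf lm0) (srealM hD) -scalerA.
have -> : srl (l - m) = srl l - srl m.
  by apply/eqP; rewrite eq_sym subr_eq -(srealD hD) subrK.
by rewrite E scaler0.
Qed.

Lemma geom_mult_diagonalizes (X : 'M[D]_3) l1 l2 :
  Defs.hermitian X -> l1 != l2 -> geom_mult X l1 2 -> geom_mult X l2 1 ->
  exists U, unitarily_diagonalizes X
    (U, \row_i (if i == ord_max then l2 else l1)).
Proof.
move=> XH l12 [V [Vinj VE]] [W [Winj WE]].
have XV (c : 'cV_2) : X *m (V *m c) = V *m c *m (srl l1)%:M by apply/VE; exists c.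
have XW (c : 'cV_1) : X *m (W *m c) = W *m c *m (srl l2)%:M by apply/WE; exists c.
have delta0 m (i : 'I_m) : delta_mx i 0 != 0 :> 'cV[D]_m.
  by apply/eqP => /colP/(_ i)/eqP; rewrite !mxE !eqxx oner_eq0.
pose e0 : 'cV[D]_2 := delta_mx 0 0; pose e1 : 'cV[D]_2 := delta_mx 1 0.
have v0 : V *m e0 != 0 by apply/eqP => /Vinj/eqP; apply/negP/delta0.
have w0 : W *m 1%:M != 0.
  by apply/eqP => /Winj/matrixP/(_ 0 0)/eqP; rewrite !mxE eqxx oner_eq0.
have [r r0 rE] := mul_adj_col v0.
(* The Gram-Schmidt coefficient, a 1 by 1 matrix; it multiplies [e0] on the right because
   eigenspaces are right vector spaces. *)
pose g := (srl r^-1)%:M *m ((V *m e0)^H *m (V *m e1)).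
(* Coordinate 1 of [e1 - e0 *m g] is 1, whatever [g] is, and [V] is injective. *)
have z0 : V *m (e1 - e0 *m g) != 0.
  apply/eqP => /Vinj/colP/(_ 1)/eqP; rewrite !mxE big1 ?subr0 ?oner_eq0 //.
  by move=> k _; rewrite !mxE mul0r.
have orth : (V *m e0)^H *m (V *m (e1 - e0 *m g)) = 0.
  rewrite mulmxBr (mulmxA V) mulmxBr (mulmxA _ _ g) rE /g (mulmxA _%:M).
  by rewrite -scalar_mxM -(srealM hD) divff ?gt_eqF // (sreal1 hD) mul1mx subrr.
have sym (x y : 'cV[D]_3) : x^H *m y = 0 -> y^H *m x = 0.
  move=> E; rewrite -[LHS]adjmxK adjmxM adjmxK E.
  by apply/matrixP => a b; rewrite !mxE sconj0.
have VW (c : 'cV_2) (c' : 'cV_1) : (V *m c)^H *m (W *m c') = 0.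
  exact: hermitian_eigvec_orthogonal XH l12 (XV c) (XW c').
pose c (i : 'I_3) := if i == ord_max then W *m 1%:M
  else if i == 0 then V *m e0 else V *m (e1 - e0 *m g).
apply: (unitarily_diagonalizes_orthogonal (c := c)).
- by move=> i; rewrite /c; case: ifP => _ //; case: ifP.
- by case=> [[|[|[|k]]] hk] [[|[|[|m]]] hm] //= _; rewrite /c /=;
    first [exact: orth | exact/sym/orth | exact: VW | exact/sym/VW].
- by move=> i; rewrite mxE /c; case: ifP => _ //; case: ifP.
Qed.

End StarDivision.

(** * Recovering the eigenvalues from traces and determinant *)

(** If [l1] occurs k times, the sum forces (k - 2)(l1 - l2) = 0, so k = 2. This gives the
    determinant for any order of the chosen eigenvalues. *)
Lemma two_valued_sum3 (R : realType) (l1 l2 : R) (d : 'rV[R]_3) :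
  l1 != l2 -> (forall i, d 0 i = l1 \/ d 0 i = l2) ->
  \sum_i d 0 i = 2 * l1 + l2 -> \prod_i d 0 i = l1 ^+ 2 * l2.
Proof.
move=> l12 hd; rewrite !big_ord_recl !big_ord0 => sd.
move: (hd ord0) (hd (lift ord0 ord0)) (hd (lift ord0 (lift ord0 ord0))) sd.
by case=> -> [] -> [] -> sd; first [ring | case/eqP: l12; lra].
Qed.

(** The radicand is 4 (l1 - l2)^2, so the root is known up to the sign of [l1 - l2]. That sign
    recovers the eigenvalues, and the determinant excludes the other one. *)
Lemma eigenvalues_from_traces (R : realType) (l1 l2 t t2 dt : R) :
  t = 2 * l1 + l2 -> t2 = 2 * l1 ^+ 2 + l2 ^+ 2 -> dt = l1 ^+ 2 * l2 ->
  l1 != l2 ->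
  let rt := Num.sqrt (6 * t2 - 2 * t ^+ 2) in
  let L1 (a : R) := (2 * t + a * rt) / 6 in
  let L2 (a : R) := (t - a * rt) / 3 in
  (exists2 a : R, a = -1 \/ a = 1 & dt = L1 a ^+ 2 * L2 a) /\
  forall a : R, a = -1 \/ a = 1 -> dt = L1 a ^+ 2 * L2 a ->
    l1 = L1 a /\ l2 = L2 a.
Proof.
move=> tE t2E dtE l12 rt L1 L2.
have rtE : rt = `|2 * (l1 - l2)|.
  by rewrite -sqrtr_sqr /rt; congr Num.sqrt; rewrite tE t2E; ring.
have [a [a1 aE]] : exists a : R, (a = -1 \/ a = 1) /\ rt = a * (2 * (l1 - l2)).
  rewrite rtE; have [h|h] := lerP 0 (2 * (l1 - l2)).
    by exists 1; split; [right|rewrite mul1r ger0_norm].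
  by exists (-1); split; [left|rewrite mulN1r ltr0_norm].
have aa : a * a = 1 by case: a1 => ->; ring.
have La : L1 a = l1 /\ L2 a = l2.
  by rewrite /L1 /L2 aE !mulrA aa tE; split; field.
split; first by exists a => //; rewrite La.1 La.2.
move=> b b1 bE; have [->|ba] := eqVneq b a; first by rewrite La.1 La.2.
have ba1 : b * a = -1.
  by case: b1 a1 ba => -> [] -> ba; rewrite ?eqxx in ba *; rewrite ?mulr1 ?mul1r.
(* For the wrong sign, [27 (L1^2 L2 - l1^2 l2) = 4 (l1 - l2)^3]. *)
have E : 4 * (l1 - l2) ^+ 3 = 27 * (L1 b ^+ 2 * L2 b - dt).
  by rewrite /L1 /L2 aE !mulrA ba1 dtE tE; field.
move/eqP: E; rewrite -bE subrr mulr0 mulf_eq0 pnatr_eq0 expf_eq0 /= subr_eq0.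
by rewrite (negPf l12).
Qed.

(** * The formula for the mean *)

Theorem theorem5p2 (R : realType) (D : scalars R)
    (hD : [\/ D = realA R, D = complexA R | D = quatA R])
    (s : 'M[D]_3 -> 'M[D]_3 -> 'M[D]_3) (f : R -> R)
    (hs : kubo_ando_mean s) (hf : representing_function s f)
    (A B : 'M[D]_3) (hA : posdef A) (hB : posdef B) (l1 l2 : R) :
  let X := mxisqrt A *m B *m mxisqrt A in
  l1 != l2 ->
  spec X = [set sreal D l1; sreal D l2] ->
  geom_mult X l1 2 -> geom_mult X l2 1 ->
  let rt := Num.sqrt (6 * eigtr (X *m X) - 2 * eigtr X ^+ 2) in
  let L1 (a : R) := (2 * eigtr X + a * rt) / 6 in
  let L2 (a : R) := (eigtr X - a * rt) / 3 in
  [/\ s A B =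
        sreal D ((l1 * f l2 - l2 * f l1) / (l1 - l2)) *: A
        + sreal D ((f l1 - f l2) / (l1 - l2)) *: B,
      exists2 a : R, a = -1 \/ a = 1 & eigdet X = L1 a ^+ 2 * L2 a &
      forall a : R, a = -1 \/ a = 1 -> eigdet X = L1 a ^+ 2 * L2 a ->
        l1 = L1 a /\ l2 = L2 a].
Proof.
move=> X l12 sX g1 g2.
have [re hre] := star_division_ex hD.
have spec_cases l : spec X (sreal D l) -> l = l1 \/ l = l2.
  by rewrite sX => -[] /(sreal_inj hre); [left|right].
have Adiag : unitarily_diagonalizes A (eigdec A).
  apply: contrapT => nA; case/eqP: l12.
  have X0 : X = 0 by rewrite /X (mxisqrt_default hre nA) !mulmx0.
  (* For [X = 0] an eigenvector satisfies [v l = 0]; multiplying by [adjmx v] gives [r l = 0] with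
     [r > 0]. *)
  have eig0 l : spec X (sreal D l) -> l = 0.
    case=> v v0; rewrite X0 mul0mx => /esym vl.
    have [r r0 rE] := mul_adj_col hre v0.
    have := congr1 (mulmx (adjmx v)) vl.
    rewrite mulmx0 mulmxA rE -scalar_mxM -(srealM hre) => /matrixP/(_ 0 0).
    rewrite !mxE eqxx mulr1n -(sreal0 hre) => /(sreal_inj hre)/eqP.
    by rewrite mulf_eq0 gt_eqF //= => /eqP.
  have S1 : spec X (sreal D l1) by rewrite sX; left.
  have S2 : spec X (sreal D l2) by rewrite sX; right.
  by rewrite (eig0 _ S1) (eig0 _ S2).
have [SS SI IS] := posdef_sqrt hre hA Adiag.
have XH : Defs.hermitian X.
  have isqrtH : adjmx (mxisqrt A) = mxisqrt A by exact: (mxfun_adj hre).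
  rewrite /Defs.hermitian /X 2!(adjmxM hre) isqrtH.
  by rewrite -hB.1 mulmxA.
have [U XU] := geom_mult_diagonalizes hre XH l12 g1 g2.
have trX : eigtr X = 2 * l1 + l2.
  rewrite (eigtrE hre XU) (diag_re_tr hre XU) !big_ord_recl big_ord0 !mxE /=.
  by ring.
have XX := diag_sqr hre XU.
have trXX : eigtr (X *m X) = 2 * l1 ^+ 2 + l2 ^+ 2.
  rewrite (eigtrE hre XX) (diag_re_tr hre XX) !big_ord_recl big_ord0 !mxE /=.
  by ring.
have detX : eigdet X = l1 ^+ 2 * l2.
  apply: two_valued_sum3 l12 _ trX => i; apply: spec_cases.
  have := eigdecP XU; case: (eigdec X) => V e h; exact: (diag_spec hre h).
move=> rt L1 L2.
have [exa alla] := eigenvalues_from_traces trX trXX detX l12.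
split=> //.
have [_ _ _ ->] := hf => //; rewrite -/X.
have d0 : l1 - l2 != 0 by rewrite subr_eq0.
(* [a] and [b] are the slope and intercept of the line through the points (l1, f l1) and (l2, f
   l2). *)
rewrite (mxfun_affine hre (a := (f l1 - f l2) / (l1 - l2))
  (b := (l1 * f l2 - l2 * f l1) / (l1 - l2)) XU); last first.
  by move=> l /spec_cases[] ->; field.
rewrite mulmxDr mulmxDl addrC (mulmx_sreal hre) (sreal_scalemx_commr hre).
rewrite -!scalemxAl SS; congr (_ + _ *: _).
(* The outer square roots cancel the inverse roots inside [X], which leaves [B]. *)
rewrite /X -(mulmxA (mxisqrt A)) (mulmxA (mxsqrt A)) SI mul1mx.
by rewrite -(mulmxA B) IS mulmx1.
Qed.
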